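(* Let $G$ be a finite transitive permutation group on a set $\Omega$ with point stabiliser $H$. Suppose that $G$ admits a base-controlling homomorphism $\phi: G\to\{1,-1\}$. Then $$b(G)=\mathrm{Diam}(\mathcal{K}(G,H))+1=d(1_H,\phi{\downarrow_H})+1.$$
   Context: All characters are complex characters. A permutation group $G$ on a finite non-empty set $\Omega$ acts faithfully on $\Omega$. A point stabiliser is $H=G_\omega$ for some $\omega\in\Omega$. For a tuple $\mathcal{A}$ of points of $\Omega$, $G_{\mathcal{A}}$ denotes its pointwise stabiliser in $G$. A base for $G$ is a sequence $\mathcal{B}$ of points of $\Omega$ with $G_{\mathcal{B}}=1$, and the base size $b(G)$ is the length of a shortest base. Convention: sequences and tuples of points are non-empty (have length at least $1$). A homomorphism $\phi:G\to\{1,-1\}$ is base-controlling if for every tuple $\mathcal{A}$ of points of $\Omega$, $\mathcal{A}$ is a base for $G$ if and only if $\phi(G_{\mathcal{A}})=1$ (that is, $\phi(g)=1$ for all $g\in G_{\mathcal{A}}$). Such a $\phi$ is a linear character of $G$, so its restriction $\phi{\downarrow_H}$ to $H$ is an irreducible character of $H$. $1_H$ denotes the trivial character of $H$, and $\uparrow^G$ and $\downarrow_H$ denote induction of characters from $H$ to $G$ and restriction of characters from $G$ to $H$. The Külshammer graph $\mathcal{K}(G,H)$ has vertex set $\mathrm{Irr}(H)$ (the irreducible characters of $H$), with $\alpha$ adjacent to $\beta$ if and only if $\alpha{\uparrow^G}$ and $\beta{\uparrow^G}$ have a common irreducible constituent. This graph is connected. For $\alpha,\beta\in\mathrm{Irr}(H)$,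 $d(\alpha,\beta)$ is the length (number of edges) of a shortest path from $\alpha$ to $\beta$ in $\mathcal{K}(G,H)$ (so $d(\alpha,\alpha)=0$), and $\mathrm{Diam}(\mathcal{K}(G,H))=\max_{\alpha,\beta\in\mathrm{Irr}(H)}d(\alpha,\beta)$. *)

(* Defs.v *)
From HB Require Import structures.
From mathcomp Require Import all_boot all_order all_algebra all_fingroup.
From mathcomp Require Import all_solvable all_field all_character.

Set Implicit Arguments.
Unset Strict Implicit.
Unset Printing Implicit Defensive.

Import GroupScope GRing.Theory.

(* The least n < N such that P n, and N itself if there is none. *)
Definition least_below (N : nat) (P : pred nat) : nat :=
  (\big[minn/N]_(n < N | P n) n)%N.

Lemma least_below_le N (P : pred nat) n : P n -> least_below N P <= n.
Proof.
rewrite /least_below => Pn; case: (ltnP n N) => [ltnN | leNn].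
  have := mem_index_enum (Ordinal ltnN); elim: (index_enum _) => // i r IH.
  rewrite inE big_cons => /predU1P[<- /= | /IH]; first by rewrite Pn geq_minl.
  by case: ifP => // _ le_r; rewrite geq_min le_r orbT.
apply: leq_trans leNn; elim/big_rec: _ => // i x _ lex.
by rewrite geq_min lex orbT.
Qed.

Lemma least_belowP N (P : pred nat) :
  least_below N P = N \/ P (least_below N P).
Proof.
rewrite /least_below; elim/big_rec: _ => [|i x Pi IH]; first by left.
by rewrite /minn; case: ifP => _; [right | exact: IH].
Qed.

Section Bases.
Variables (T : finType) (G : {group {perm T}}).

Definition pointwise_stab (A : seq T) : {set {perm T}} :=
  'C_G([set x in A] | 'P).

Definition is_base (B : seq T) : bool :=
  (B != [::]) && (pointwise_stab B == 1).

(* When T is non-empty, listing all of T gives a base of length #|T|, so the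
   bound #|T| is harmless; see base_size_attained and base_size_min. *)
Definition base_size : nat :=
  least_below #|T| (fun n => [exists B : n.-tuple T, is_base B]).

Lemma is_base_enum (w : T) : is_base (enum T).
Proof.
apply/andP; split; first by rewrite -size_eq0 -cardE -lt0n; apply/card_gt0P; exists w.
rewrite eqEsubset sub1G andbT; apply/subsetP => g /setIP[_ /astabP cg].
by rewrite inE; apply/eqP/permP => x; rewrite perm1 -[LHS]/('P%act x g) cg ?inE ?mem_enum.
Qed.

Lemma base_size_attained (w : T) : exists2 B, is_base B & size B = base_size.
Proof.
have [eN | /existsP[B bB]] := least_belowP #|T|
  (fun n => [exists B : n.-tuple T, is_base B]).
  by exists (enum T); rewrite ?(is_base_enum w) // -cardE /base_size eN.
by exists B => //; rewrite size_tuple.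
Qed.

Lemma base_size_min B : is_base B -> base_size <= size B.
Proof. by move=> bB; apply: least_below_le; apply/existsP; exists (in_tuple B). Qed.

(* Functions on G with values in {1, -1} that are homomorphisms are class
   functions, so nothing is lost by taking phi in 'CF(G). *)
Definition sign_hom (phi : 'CF(G)) : Prop :=
  {in G, forall g, phi g = 1%R \/ phi g = (-1)%R}
  /\ {in G &, {morph phi : g h / g * h >-> (g * h)%R}}.

Definition base_controlling (phi : 'CF(G)) : Prop :=
  sign_hom phi
  /\ forall A : seq T, A != [::] ->
       is_base A <-> {in pointwise_stab A, forall g, phi g = 1%R}.

End Bases.

Section Distance.
Variables (V : finType) (e : rel V).

(* A shortest path has fewer than #|V| edges; the value is #|V| when y cannot
   be reached from x. *)
Definition dist (x y : V) : nat :=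
  least_below #|V|
    (fun n => [exists p : n.-tuple V, path e x p && (last x p == y)]).

Definition diam : nat := (\max_(x : V) \max_(y : V) dist x y)%N.

Lemma dist_min x p : path e x p -> dist x (last x p) <= size p.
Proof.
move=> ep; apply: least_below_le; apply/existsP; exists (in_tuple p).
by rewrite ep eqxx.
Qed.

Lemma dist_attained x y : connect e x y ->
  exists p, [/\ path e x p, last x p = y & size p = dist x y].
Proof.
case/connectP=> p0 ep0 ->; case/shortenP: ep0 => p ep up _.
have ltp : dist x (last x p) < #|V|.
  by apply: leq_ltn_trans (dist_min ep) _; rewrite -[_.+1]/(size (x :: p)) -(card_uniqP up) max_card.
have [eN | /existsP[q /andP[eq /eqP lq]]] := least_belowP #|V|
  (fun n => [exists q : n.-tuple V, path e x q && (last x q == last x p)]).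
  by rewrite /dist eN ltnn in ltp.
by exists q; rewrite size_tuple.
Qed.

End Distance.

(* The vertex set Irr(H) is represented by its index type Iirr H; every vertex
   is related to itself, which does not affect distances. *)
Definition kulshammer (gT : finGroupType) (G H : {group gT}) : rel (Iirr H) :=
  fun i j => [exists k : Iirr G, (k \in irr_constt ('Ind[G] 'chi_i)%R)
                              && (k \in irr_constt ('Ind[G] 'chi_j)%R)].

(* cfIirr alpha is the index of alpha in Irr(H), when alpha is irreducible. *)
Definition kulshammer_dist (gT : finGroupType) (G H : {group gT})
    (alpha beta : 'CF(H)) : nat :=
  dist (@kulshammer gT G H) (cfIirr alpha) (cfIirr beta).

Definition kulshammer_diam (gT : finGroupType) (G H : {group gT}) : nat :=
  diam (@kulshammer gT G H).
Arguments kulshammer_dist {gT} G H alpha beta.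
Arguments kulshammer_diam {gT} G H.

(* Main.v *)
Require Import Defs.
From HB Require Import structures.
From mathcomp Require Import all_boot all_order all_algebra all_fingroup.
From mathcomp Require Import all_solvable all_field all_character.

Set Implicit Arguments.
Unset Strict Implicit.
Unset Printing Implicit Defensive.

Import GroupScope GRing.Theory.
Import Num.Theory.

(** Walks in the graph K(G, H) are governed by intersections of conjugates
    of H. By Frobenius reciprocity alpha is adjacent to gamma iff gamma is a
    constituent of the restriction to H of the induced character of alpha;
    Mackey's formula turns this into alpha and some conjugate gamma^y having
    a common constituent on H :&: H :^ y^-1. Iterating this gives
    [kulshammer_walkP]: there is a walk of length n from alpha to beta iff
    there are n elements of G such that alpha and a suitable conjugate of beta
    have a common constituent on K, the intersection of H with n conjugates of
    H that these elements determine. For a transitive permutation group with point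
    stabiliser H, the groups K are, up to conjugacy, the pointwise stabilisers
    of the tuples of n + 1 points.

    A base of length b = b(G) yields b - 1 elements with K = 1. On the trivial
    group any two characters have a common constituent, so every two vertices
    are joined by a walk of length b - 1, and the diameter is at most b - 1.

    Conversely, let d be the distance from the trivial character to the
    restriction of phi. A shortest walk gives a K, which is the stabiliser of
    a tuple of d + 1 points, on which the trivial character and phi have a
    common constituent. Both are linear, so phi is trivial on K; as phi is
    base-controlling, the tuple is a base and b <= d + 1. Since d is at most
    the diameter, all the inequalities are equalities. *)

(** * Mackey's criterion for induced characters to meet *)

Section Mackey.
Variable gT : finGroupType.
Implicit Types G H K L : {group gT}.

(** Multiplicities are natural numbers, so no cancellation can occur in the
    expansion of the inner product over the irreducible characters. *)
Lemma cfdot_char_neq0P G (chi xi : 'CF(G)) :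
    chi \is a character -> xi \is a character ->
  reflect (exists2 i, i \in irr_constt chi & i \in irr_constt xi)
          ('[chi, xi] != 0)%R.
Proof.
move=> Nchi Nxi; apply: (iffP idP) => [nz | [i ci xi_i]].
  have [i /andP[ci xi_i] | none] :=
    pickP (fun i => (i \in irr_constt chi) && (i \in irr_constt xi)).
    by exists i.
  case/eqP: nz; rewrite cfdot_sum_irr big1 // => i _.
  have /nandP[] := negbT (none i); rewrite irr_consttE negbK => /eqP->.
    by rewrite mul0r.
  by rewrite rmorph0 mulr0.
apply/eqP => /(constt_ortho_char Nchi Nxi ci xi_i)/eqP.
by rewrite cfnorm_irr oner_eq0.
Qed.

(** The function g |-> a (g ^ x) on K, meaningful when K :^ x \subset H. It is
    built from a restriction and an inflation along conjugation so that
    characters are visibly sent to characters. *)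
Definition cfResConj H K (x : gT) (a : 'CF(H)) : 'CF(K) :=
  cfMorph ('Res[(conjgm_morphism K x @* K)%G] a)%R.

Lemma cfResConj_char H K x (a : 'CF(H)) :
  a \is a character -> cfResConj K x a \is a character.
Proof. by move=> Na; apply/cfMorph_char/cfRes_char. Qed.

Lemma cfResConjE H K x (a : 'CF(H)) g :
  K :^ x \subset H -> g \in K -> cfResConj K x a g = a (g ^ x).
Proof.
move=> sKH Kg; rewrite cfMorphE // cfResE //= ?morphim_conj ?setIid //.
by rewrite memJ_conjg.
Qed.

Lemma cfResConj1 H (a : 'CF(H)) : cfResConj H 1 a = a.
Proof. by apply/cfun_inP=> g Hg; rewrite cfResConjE ?conjsg1 ?conjg1. Qed.

Lemma cfResConj_Res G H K x (a : 'CF(G)) :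
    H \subset G -> K \subset G -> K :^ x \subset H -> x \in G ->
  cfResConj K x ('Res[H] a)%R = ('Res[K] a)%R.
Proof.
move=> sHG sKG sKH Gx; apply/cfun_inP=> g Kg; rewrite cfResConjE //.
by rewrite !cfResE ?cfunJ // (subsetP sKH) ?memJ_conjg.
Qed.

(** Mackey's formula, summed over all of G instead of over representatives of
    the (H, L)-double cosets: the orders of the intersections are the weights
    that account for the repetitions. *)
Lemma cfdot_Ind_sum G H L (a : 'CF(H)) (b : 'CF(L)) :
    H \subset G -> L \subset G ->
  ('['Ind[G] a, 'Ind[G] b] = (#|H|%:R^-1 * #|L|%:R^-1) *
     \sum_(y in G) #|H :&: L :^ y^-1|%:R *
       '['Res[(H :&: L :^ y^-1)%G] a, cfResConj _ y b])%R.
Proof.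
move=> sHG sLG; rewrite -cfdot_Res_r cfdotE -mulrA; congr (_ * _)%R.
under eq_bigr => g Hg.
  rewrite cfResE // cfIndE // rmorphM /= rmorph_sum fmorphV rmorph_nat mulrCA.
  rewrite big_distrr; over.
rewrite -big_distrr exchange_big /=; congr (_ * _)%R; apply: eq_bigr => y Gy.
rewrite cfdotE mulVKf; last by rewrite pnatr_eq0 -lt0n cardG_gt0.
(* Class functions vanish outside their group, so only the g with g ^ y \in L
   contribute. *)
rewrite [LHS](bigID (fun g => g \in L :^ y^-1)) /= [X in (_ + X)%R]big1 => [|g].
  rewrite addr0; apply: eq_big => g; first by rewrite inE.
  case/andP=> Hg Lg; rewrite cfResE ?subsetIl ?inE ?Hg //.
  rewrite cfResConjE ?inE ?Hg //.
  by rewrite sub_conjg subsetIr.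
by case/andP=> _; rewrite mem_conjgV => /cfun0->; rewrite rmorph0 mulr0.
Qed.

Lemma cfdot_Ind_neq0P G H L (a : 'CF(H)) (b : 'CF(L)) :
    H \subset G -> L \subset G -> a \is a character -> b \is a character ->
  reflect (exists2 y, y \in G &
             '['Res[(H :&: L :^ y^-1)%G] a, cfResConj _ y b] != 0)%R
          ('['Ind[G] a, 'Ind[G] b] != 0)%R.
Proof.
move=> sHG sLG Na Nb; rewrite cfdot_Ind_sum //.
have cn0 (A : {group gT}) : (#|A|%:R != 0 :> algC)%R.
  by rewrite pnatr_eq0 -lt0n cardG_gt0.
have ge0 y : (0 <= #|H :&: L :^ y^-1|%:R *
    '['Res[(H :&: L :^ y^-1)%G] a, cfResConj _ y b])%R.
  rewrite mulr_ge0 ?ler0n // natr_ge0 //.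
  by rewrite Cnat_cfdot_char ?cfRes_char ?cfResConj_char.
rewrite !mulf_eq0 !invr_eq0 !(negbTE (cn0 _)) /= psumr_neq0 => [|y _] //.
apply: (iffP hasP) => [[y _ /andP[Gy]] | [y Gy nz]].
  by rewrite lt0r mulf_eq0 => /andP[/norP[_ nz] _]; exists y.
exists y; rewrite ?mem_index_enum // Gy lt0r ge0 andbT.
by rewrite mulf_neq0 ?(cn0 _).
Qed.

End Mackey.

(** * Walks in the Kuelshammer graph *)

Section Walks.
Variable gT : finGroupType.
Implicit Types G H : {group gT}.

Lemma kulshammerE G H i j :
  @kulshammer _ G H i j = ('['Ind[G] 'chi_i, 'Ind[G] 'chi_j] != 0)%R.
Proof.
have Nind k : ('Ind[G, H] 'chi_k)%R \is a character.
  by rewrite cfInd_char ?irr_char.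
apply/existsP/(cfdot_char_neq0P (Nind i) (Nind j)).
  by case=> k /andP[ik jk]; exists k.
by case=> k ik jk; exists k; rewrite ik.
Qed.

(** For s = [:: y1; ...; yn] this is the intersection of the conjugates of H
    by the inverses of 1, y1, y1 * y2, ..., y1 * ... * yn. Recording
    increments makes the first edge of a walk correspond to the head of s. *)
Fixpoint walk_stab H (s : seq gT) : {group gT} :=
  if s is y :: t then (H :&: walk_stab H t :^ y^-1)%G else H.

Lemma walk_stab_sub H s : walk_stab H s \subset H.
Proof. by case: s => //= y t; rewrite subsetIl. Qed.

Lemma walk_stabJ_sub H s : walk_stab H s :^ (\prod_(y <- s) y) \subset H.
Proof.
elim: s => [|y t IHt] /=; first by rewrite big_nil conjsg1.
rewrite big_cons conjsgM conjIg conjsgKV.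
by apply: subset_trans IHt; rewrite conjSg subsetIr.
Qed.

(** By induction on n. Put K = walk_stab H t and let b be the conjugate of
    'chi_j on K. Inducing b from K to G in two stages, through H, shows that
    the characters of G induced from 'chi_i and b meet iff 'chi_i has a
    neighbour 'chi_k that meets b on K, which is the first edge of a walk
    followed by the induction hypothesis. Mackey's criterion says that they
    meet iff, for some y, 'chi_i meets the conjugate of b by y on
    H :&: K :^ y^-1, which is the condition for y :: t. *)
Lemma kulshammer_walkP G H (n : nat) (i j : Iirr H) : H \subset G ->
  (exists p, [/\ path (@kulshammer _ G H) i p, last i p = j & size p = n]) <->
  (exists s, [/\ {subset s <= G}, size s = n
     & '['Res[walk_stab H s] 'chi_i,
         cfResConj _ (\prod_(y <- s) y) 'chi_j] != 0])%R.
Proof.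
move=> sHG; elim: n i => [|n IHn] i.
  split=> [[p [_ <- /size0nil->]] | [s [_ /size0nil-> nz]]].
    exists [::]; split=> //=.
    by rewrite big_nil cfResConj1 cfRes_id cfnorm_irr oner_eq0.
  exists [::]; split=> //=; move: nz.
  rewrite big_nil /= cfResConj1 cfRes_id cfdot_irr.
  by case: (i =P j) => // _; rewrite mulr0n eqxx.
have Nchi k : ('chi[H]_k)%R \is a character by apply: irr_char.
pose b t : 'CF(walk_stab H t) := cfResConj _ (\prod_(y <- t) y) ('chi_j)%R.
have Nb t : b t \is a character by apply: cfResConj_char.
have sKG t : walk_stab H t \subset G := subset_trans (walk_stab_sub H t) sHG.
have bJ y t : cfResConj (walk_stab H (y :: t)) y (b t) = b (y :: t).
  apply/cfun_inP=> g Kg; have /setIP[Hg Kgy] := Kg.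
  rewrite cfResConjE //=; last by rewrite sub_conjg subsetIr.
  by rewrite !cfResConjE ?walk_stabJ_sub // ?big_cons ?conjgM // -mem_conjgV.
have step t : reflect
    (exists2 k, @kulshammer _ G H i k & '['Res[walk_stab H t] 'chi_k, b t] != 0)%R
    ('['Ind[G] 'chi_i, 'Ind[G] (b t)] != 0)%R.
  rewrite -(cfIndInd (b t) sHG (walk_stab_sub H t)) -cfdot_Res_l.
  have Nres : ('Res[H] ('Ind[G] 'chi[H]_i))%R \is a character.
    by rewrite cfRes_char ?cfInd_char.
  have Nind : ('Ind[H] (b t))%R \is a character by rewrite cfInd_char.
  have eq_k k : (k \in irr_constt ('Res[H] ('Ind[G] 'chi[H]_i)))%R =
                @kulshammer _ G H i k.
    by rewrite irr_consttE cfdot_Res_l kulshammerE.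
  have eq_b k : (k \in irr_constt ('Ind[H] (b t)))%R =
      ('['Res[walk_stab H t] 'chi_k, b t] != 0)%R.
    by rewrite irr_consttE cfdot_Res_l cfdotC fmorph_eq0.
  apply: (iffP (cfdot_char_neq0P Nres Nind)) => -[k ik bk]; exists k => //.
  - by rewrite -eq_k.
  - by rewrite -eq_b.
  - by rewrite eq_k.
  - by rewrite eq_b.
split=> [[[|k p] []] // /= /andP[ik kp] lp [sp] | [[|y t] []] // sG [st] nz].
  have [|t [tG st nz]] := (IHn k).1; first by exists p.
  have nzI : ('['Ind[G] 'chi_i, 'Ind[G] (b t)] != 0)%R by apply/step; exists k.
  case/cfdot_Ind_neq0P: nzI => // y Gy; rewrite bJ => nzy.
  exists (y :: t); split=> //=; last by rewrite st.
  by move=> z; rewrite inE => /predU1P[->|/tG].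
have Gy : y \in G by rewrite sG ?mem_head.
have /step[k ik nzk] : ('['Ind[G] 'chi_i, 'Ind[G] (b t)] != 0)%R.
  by apply/cfdot_Ind_neq0P=> //; exists y; rewrite // bJ.
have [|p [kp lp sp]] := (IHn k).2.
  by exists t; split=> // z tz; rewrite sG // inE tz orbT.
by exists (k :: p); rewrite /= ik kp sp.
Qed.

(** On the trivial group the inner product of two characters is the product of
    their degrees. *)
Lemma kulshammer_walk_triv G H s (i j : Iirr H) :
    H \subset G -> {subset s <= G} -> walk_stab H s = 1%G ->
  exists p, [/\ path (@kulshammer _ G H) i p, last i p = j & size p = size s].
Proof.
move=> sHG sG K1; apply/kulshammer_walkP=> //; exists s; split=> //.
rewrite cfdotE K1 cards1 invr1 mul1r big_set1.
rewrite cfResE ?sub1G ?group1 // cfResConjE ?conjs1g ?sub1G //.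
by rewrite conj1g mulf_neq0 ?fmorph_eq0 ?irr1_neq0.
Qed.

End Walks.

(** * Pointwise stabilisers as intersections of conjugates *)

Section Stabilisers.
Variables (T : finType) (G : {group {perm T}}).

Lemma pointwise_stab1 a : pointwise_stab G [:: a] = 'C_G[a | 'P].
Proof. by congr (_ :&: 'C(_ | _)); apply/setP=> x; rewrite !inE. Qed.

Lemma pointwise_stab_cons a B :
  pointwise_stab G (a :: B) = 'C_G[a | 'P] :&: pointwise_stab G B.
Proof.
rewrite /pointwise_stab -setIIr -astabU.
by congr (_ :&: 'C(_ | _)); apply/setP=> x; rewrite !inE.
Qed.

Lemma pointwise_stab_map z B : z \in G ->
  pointwise_stab G (map (fun a => aperm a z) B) = pointwise_stab G B :^ z.
Proof.
move=> Gz; rewrite /pointwise_stab conjIg conjGid // -astab_setact.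
congr (_ :&: 'C(_ | _)); apply/setP=> x; rewrite inE.
by apply/mapP/imsetP=> -[a Ba ->]; exists a => //; move: Ba; rewrite inE.
Qed.

Lemma walk_stab_points w s : {subset s <= G} ->
  exists2 B, size B = size s &
    pointwise_stab G (w :: B) = walk_stab ('C_G[w | 'P])%G s.
Proof.
elim: s => [|y t IHt] sG; first by exists [::]; rewrite ?pointwise_stab1.
have [|B sB eB] := IHt; first by move=> z tz; rewrite sG // inE tz orbT.
exists (map (fun a => aperm a y^-1) (w :: B)); first by rewrite size_map /= sB.
rewrite pointwise_stab_cons pointwise_stab_map ?groupV ?sG ?mem_head //.
by rewrite eB.
Qed.

(** The conjugating element x carries w to the head of the tuple; it is needed
    because [walk_stab] always starts from the stabiliser of w itself. *)
Lemma points_walk_stab w a B : [transitive G, on [set: T] | 'P] ->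
  exists s, [/\ {subset s <= G}, size s = size B &
    exists2 x, x \in G &
      pointwise_stab G (a :: B) = walk_stab ('C_G[w | 'P])%G s :^ x].
Proof.
move=> Gtr; elim: B a => [|b B IHB] a;
  have [x Gx ->] := atransP2 Gtr (in_setT w) (in_setT a).
  exists [::]; split=> //; exists x => //=.
  by rewrite pointwise_stab1 conjIg conjGid // -astab1_act.
have [t [tG st [z Gz eB]]] := IHB b.
exists (x * z^-1 :: t); split=> /=; [|by rewrite st|].
  by move=> u; rewrite inE => /predU1P[->|/tG //]; rewrite groupM ?groupV.
exists x => //; rewrite pointwise_stab_cons eB astab1_act.
rewrite [RHS]conjIg -conjsgM invMg invgK mulgKV; congr (_ :&: _).
by rewrite [RHS]conjIg conjGid.
Qed.

End Stabilisers.

(** * Linear characters *)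

Section Linear.
Variable gT : finGroupType.
Implicit Types G : {group gT}.

Lemma mul_morph_lin_char G (phi : 'CF(G)) :
    phi 1 = 1%R -> {in G &, {morph phi : g h / g * h >-> (g * h)%R}} ->
  phi \is a linear_char.
Proof.
move=> phi1 phiM.
have rP : mx_repr G (fun g => (phi g)%:M%R : 'M[algC]_1).
  by split=> [|g h Gg Gh]; rewrite ?phi1 // phiM // scalar_mxM.
have -> : phi = cfRepr (MxRepresentation rP).
  by apply/cfun_inP=> g Gg; rewrite cfunE Gg mxtrace_scalar.
by rewrite qualifE /= cfRepr_char cfRepr1 eqxx.
Qed.

Lemma cfdot1_lin_char G (lam : 'CF(G)) :
  lam \is a linear_char -> ('[lam, 1] != 0)%R -> lam = 1%R.
Proof.
move=> /lin_char_irr/irrP[i ->]; rewrite -irr0 cfdot_irr.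
by case: (i =P 0%R) => [->|_] //; rewrite mulr0n eqxx.
Qed.

End Linear.

Lemma sign_hom_lin_char (T : finType) (G : {group {perm T}}) (phi : 'CF(G)) :
  sign_hom phi -> phi \is a linear_char.
Proof.
case=> phi_pm phiM; apply: mul_morph_lin_char => //.
have := phiM 1 1 (group1 G) (group1 G); rewrite mulg1.
case: (phi_pm 1 (group1 G)) => -> //; rewrite mulrNN mulr1 => /eqP.
by rewrite eqNr oner_eq0.
Qed.

(** * Base size, diameter and distance *)

Theorem theorem1p2 (T : finType) (G H : {group {perm T}}) (w : T)
    (phi : 'CF(G))
    (Gtrans : [transitive G, on [set: T] | 'P])
    (Hstab : H :=: 'C_G[w | 'P])
    (phi_bc : base_controlling phi) :
  base_size G = (kulshammer_diam G H).+1
  /\ (kulshammer_diam G H).+1 = (kulshammer_dist G H 1%R ('Res[H] phi)%R).+1.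
Proof.
have sHG : H \subset G by rewrite Hstab subsetIl.
have eH : H = ('C_G[w | 'P])%G by apply: val_inj.
have [phi_sgn phi_base] := phi_bc.
have Lphi := sign_hom_lin_char phi_sgn.
have Lphi_H : ('Res[H] phi)%R \is a linear_char by rewrite cfRes_lin_char.
set b := base_size G; set i1 := cfIirr (1 : 'CF(H))%R.
set iphi := cfIirr ('Res[H] phi)%R.
have [B /andP[Bnz /eqP B1] sB] := base_size_attained G w.
case: B => [|a B] // in Bnz B1 sB *.
have [s [sG ss [x Gx eK]]] := points_walk_stab w a B Gtrans.
have K1 : walk_stab H s = 1%G.
  by apply: val_inj; apply/eqP; rewrite eH -(conjsg_eq1 _ x) -eK B1.
have walk i j : exists p,
    [/\ path (@kulshammer _ G H) i p, last i p = j & size p = b.-1].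
  by have := kulshammer_walk_triv i j sHG sG K1; rewrite /b -sB /= ss.
have le_dist i j : dist (@kulshammer _ G H) i j <= b.-1.
  by have [p [ep <- <-]] := walk i j; apply: dist_min.
have le_diam : kulshammer_diam G H <= b.-1.
  by apply/bigmax_leqP=> i _; apply/bigmax_leqP=> j _.
have le_d : kulshammer_dist G H 1%R ('Res[H] phi)%R <= kulshammer_diam G H.
  rewrite /kulshammer_diam /diam (bigD1 i1) //= (bigD1 iphi) //=.
  by rewrite !leq_max leqnn.
have le_b : b <= (kulshammer_dist G H 1%R ('Res[H] phi)%R).+1.
  have [|p [ep lp sp]] := @dist_attained _ (@kulshammer _ G H) i1 iphi.
    by have [p [ep <- _]] := walk i1 iphi; apply/connectP; exists p.
  rewrite -[kulshammer_dist _ _ _ _]sp.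
  have [|t [tG st nz]] := (kulshammer_walkP (size p) i1 iphi sHG).1.
    by exists p.
  have [C sC eC] := walk_stab_points w tG.
  have sKG := subset_trans (walk_stab_sub H t) sHG.
  have Gt : \prod_(y <- t) y \in G.
    by rewrite big_seq; apply: group_prod => y /tG.
  (* phi is constant on the conjugacy classes of G, so the conjugation that
     comes with the walk does not affect it. *)
  have Kphi : ('Res[walk_stab H t] phi = 1)%R.
    apply: cfdot1_lin_char (cfRes_lin_char _ Lphi) _; move: nz.
    rewrite !cfIirrE ?lin_char_irr ?cfun1_lin_char // cfdotC fmorph_eq0.
    by rewrite cfResConj_Res ?walk_stabJ_sub // rmorph1.
  have baseC : is_base G (w :: C).
    apply/phi_base=> // g; rewrite eC -eH => Kg.
    by rewrite -(cfResE _ sKG Kg) Kphi cfun1E Kg.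
  by have := base_size_min baseC; rewrite /= sC st.
have b_gt0 : 0 < b by rewrite /b -sB.
have eq_d : kulshammer_diam G H = kulshammer_dist G H 1%R ('Res[H] phi)%R.
  apply/eqP; rewrite eqn_leq le_d andbT (leq_trans le_diam) //.
  by rewrite -ltnS prednK.
rewrite -eq_d; split=> //; apply/eqP.
by rewrite eqn_leq -{2}(prednK b_gt0) ltnS le_diam eq_d le_b.
Qed.
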